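(* Let $\bar Q$ be the true parameter in the agents' optimal control problem and let $\{\bar P_t\}_{t=1}^N$ be the corresponding solution of the discrete-time Riccati equation. Under Assumptions (1), (2), (3) listed in the context, if $N\ge n+1$, then $(\bar Q,\{\bar P_t\}_{t=1}^N)$ is the unique optimal solution of the problem $$\text{minimize }\mathbb{E}\big[H_S^{\boldsymbol{Y}}(Q,\{P_t\})\big]\quad\text{subject to }(Q,\{P_t\}_{t=1}^N)\in\mathscr{D}(\varphi).$$
   Context: Notation: $\mathbb{S}^n_+$ is the set of symmetric positive semidefinite $n\times n$ real matrices; $\succeq$ and $\succ$ refer to positive semidefiniteness/definiteness; $\|\cdot\|_F$ is the Frobenius norm; $\mathrm{cov}(\boldsymbol{x},\boldsymbol{x})$ is the covariance matrix of $\boldsymbol{x}$. Bold letters denote random elements. Standing assumptions on the system: $A\in\mathbb{R}^{n\times n}$ is invertible, $B\in\mathbb{R}^{n\times m}$ has full column rank, $(A,B)$ is controllable. Assumptions, on a probability space $(\Omega,\mathcal{F},\mathbb{P})$ carrying random vectors $\boldsymbol{x}_1^i\in\mathbb{R}^n$ and $\boldsymbol{v}_t^i\in\mathbb{R}^n$ ($t=1,\dots,N$; $i=1,\dots,M$): (1) all of these vectors are independent; the $\boldsymbol{x}_1^i$ are identically distributed; the $\boldsymbol{v}_t^i$ are identically distributed over all $t,i$; $\mathbb{E}[\boldsymbol{v}_t^i]=0$ and $\mathrm{cov}(\boldsymbol{v}_t^i,\boldsymbol{v}_t^i)=\Sigma$ is known with $\|\Sigma\|_F<\infty$. (2) $\mathrm{cov}(\boldsymbol{x}_1^i,\boldsymbol{x}_1^i)\succ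 0$ and $\mathbb{E}[\|\boldsymbol{x}_1^i\|^2]<\infty$. (3) The true parameter satisfies $\bar Q\in\bar{\mathbb{S}}^n_+(\varphi):=\{Q\in\mathbb{S}^n_+:\|Q\|_F^2\le\varphi\}$ for some given $0<\varphi<\infty$. Data: for each $i$ and each $\omega\in\Omega$, $\{\boldsymbol{x}_t^i(\omega)\}_{t=1}^N$ is the optimal state trajectory of the problem of minimizing $x_N^T\bar Qx_N+\sum_{t=1}^{N-1}(x_t^T\bar Qx_t+u_t^Tu_t)$ subject to $x_{t+1}=Ax_t+Bu_t$, $x_1=\boldsymbol{x}_1^i(\omega)$. The observations are $\boldsymbol{Y}_t^\phi=[\tilde{\boldsymbol{x}}_t^{\phi_t(1)},\dots,\tilde{\boldsymbol{x}}_t^{\phi_t(M)}]$, $t=1,\dots,N$, where $\tilde{\boldsymbol{x}}_t^i=\boldsymbol{x}_t^i+\boldsymbol{v}_t^i$ and $\phi_t$ are unknown permutations of $\{1,\dots,M\}$. Riccati equation: $\bar P_N=\bar Q$ and $\bar P_t=A^T\bar P_{t+1}A+\bar Q-A^T\bar P_{t+1}B(B^T\bar P_{t+1}B+I)^{-1}B^T\bar P_{t+1}A$ for $t=1,\dots,N-1$. Domain: $\mathscr{D}(\varphi)$ is the set of all $(Q,\{P_t\}_{t=1}^N)$ with $Q\in\bar{\mathbb{S}}^n_+(\varphi)$, $P_t\in\mathbb{S}^n_+$ for $t=1,\dots,N$, such that $P_N=Q$ and $$\begin{bmatrix}B^TP_{t+1}B+I & B^TP_{t+1}A\\ A^TP_{t+1}B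 & A^TP_{t+1}A+Q-P_t\end{bmatrix}\succeq 0,\quad t=1,\dots,N-1.$$ Objective: $$H_S^{\boldsymbol{Y}}(Q,\{P_t\}):=\frac1M\Big[-\mathrm{tr}(P_1\boldsymbol{Y}_1^\phi\boldsymbol{Y}_1^{\phi T})+\mathrm{tr}(P_N\boldsymbol{Y}_N^\phi\boldsymbol{Y}_N^{\phi T})+\sum_{t=1}^{N-1}\mathrm{tr}(Q\boldsymbol{Y}_t^\phi\boldsymbol{Y}_t^{\phi T})+M\big(\mathrm{tr}(P_1\Sigma)-\mathrm{tr}(P_N\Sigma)-(N-1)\mathrm{tr}(Q\Sigma)\big)\Big].$$ *)

(* Defs.v *)
From HB Require Import structures.
From mathcomp Require Import all_boot all_order all_algebra all_fingroup.
From mathcomp Require Import all_classical all_reals all_analysis.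
Set Implicit Arguments.
Unset Strict Implicit.
Unset Printing Implicit Defensive.
Import Order.TTheory GRing.Theory Num.Theory numFieldNormedType.Exports.
Local Open Scope classical_set_scope.
Local Open Scope ring_scope.

(* Time-indexed families (states, inputs, noises, Riccati matrices) are
   functions on nat of which only the values at the times 1, ..., N matter;
   two such families are identified when they agree at these times.  Agents are
   indexed by 'I_M. *)

Section Matrices.
Context {R : realType}.

(* For column vectors this is the Euclidean norm. *)
Definition frobenius m n (A : 'M[R]_(m, n)) : R :=
  Num.sqrt (\sum_i \sum_j A i j ^+ 2).

Definition qform n (Q : 'M[R]_n) (x : 'cV[R]_n) : R := (x^T *m Q *m x) 0 0.

Definition psdmx n (Q : 'M[R]_n) : Prop :=
  Q^T = Q /\ forall x : 'cV[R]_n, 0 <= qform Q x.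

Definition pdmx n (Q : 'M[R]_n) : Prop :=
  Q^T = Q /\ forall x : 'cV[R]_n, x != 0 -> 0 < qform Q x.

Definition psd_ball n (phi : R) : set 'M[R]_n :=
  [set Q | psdmx Q /\ frobenius Q ^+ 2 <= phi].

End Matrices.

Section Control.
Context {R : realType} {n m : nat}.
Implicit Types (A : 'M[R]_n) (B : 'M[R]_(n, m)) (Q S : 'M[R]_n).
Implicit Types (P : nat -> 'M[R]_n).
Implicit Types (x : nat -> 'cV[R]_n) (u : nat -> 'cV[R]_m).

Definition dynamics A B (t0 t1 : nat) x u : Prop :=
  forall t, (t0 <= t < t1)%N -> x t.+1 = A *m x t + B *m u t.

Definition controllable A B : Prop :=
  forall a b : 'cV[R]_n, exists (k : nat) x u,
    [/\ x 0%N = a, x k = b & dynamics A B 0 k x u].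

Definition lq_cost Q (N : nat) x u : R :=
  qform Q (x N) + \sum_(1 <= t < N) (qform Q (x t) + ((u t)^T *m u t) 0 0).

Definition optimal_trajectory A B Q (N : nat) (x1 : 'cV[R]_n) x : Prop :=
  exists u, [/\ x 1%N = x1, dynamics A B 1 N x u &
    forall y w, y 1%N = x1 -> dynamics A B 1 N y w ->
      lq_cost Q N x u <= lq_cost Q N y w].

Definition riccati A B Q (N : nat) P : Prop :=
  P N = Q /\
  forall t, (1 <= t < N)%N ->
    P t = A^T *m P t.+1 *m A + Q
          - A^T *m P t.+1 *m B *m invmx (B^T *m P t.+1 *m B + 1%:M)
            *m B^T *m P t.+1 *m A.

Definition riccati_lmi A B Q (Pnext Pcur : 'M[R]_n) : 'M[R]_(m + n) :=
  block_mx (B^T *m Pnext *m B + 1%:M) (B^T *m Pnext *m A)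
           (A^T *m Pnext *m B)        (A^T *m Pnext *m A + Q - Pcur).

Definition ioc_domain A B (N : nat) (phi : R) :
    set ('M[R]_n * (nat -> 'M[R]_n)) :=
  [set z | let: (Q, P) := z in
    [/\ psd_ball phi Q,
        forall t, (1 <= t <= N)%N -> psdmx (P t),
        P N = Q &
        forall t, (1 <= t < N)%N -> psdmx (riccati_lmi A B Q (P t.+1) (P t))]].

Definition ioc_objective (M N : nat) S (Y : nat -> 'M[R]_(n, M))
    (z : 'M[R]_n * (nat -> 'M[R]_n)) : R :=
  let: (Q, P) := z in
  M%:R^-1 * (- \tr (P 1%N *m Y 1%N *m (Y 1%N)^T)
             + \tr (P N *m Y N *m (Y N)^T)
             + \sum_(1 <= t < N) \tr (Q *m Y t *m (Y t)^T)
             + M%:R * (\tr (P 1%N *m S) - \tr (P N *m S)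
                       - N.-1%:R * \tr (Q *m S))).

End Control.

Definition minimizers (R : realType) (X : Type) (f : X -> \bar R) (D : set X) :
    set X :=
  [set z | D z /\ forall z', D z' -> (f z <= f z')%E].

Section RandomVectors.
Context {d : measure_display} {T : measurableType d} {R : realType}.
Context {n : nat}.
Implicit Types (Pr : probability T R) (X Y : T -> 'cV[R]_n).

Definition borel_cV : set (set 'cV[R]_n) := <<s [set U | open U] >>.

Definition random_vector X : Prop :=
  forall C, borel_cV C -> measurable (X @^-1` C).

Definition identically_distributed Pr X Y : Prop :=
  forall C, borel_cV C -> Pr (X @^-1` C) = Pr (Y @^-1` C).

Definition mutually_independent Pr (I : finType) (X : I -> T -> 'cV[R]_n) :
    Prop :=
  forall (J : {set I}) (C : I -> set 'cV[R]_n),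
    (forall k, borel_cV (C k)) ->
    Pr (\bigcap_(k in [set` J]) (X k @^-1` C k)) =
    (\prod_(k in J) Pr (X k @^-1` C k))%E.

Definition covmx Pr X : 'M[\bar R]_n :=
  \matrix_(j, k) covariance Pr (fun w => X w j 0) (fun w => X w k 0).

End RandomVectors.

(* The initial states together with the noises at the times 1, ..., N. *)
Definition primitive_family (T : Type) (R : realType) (n M N : nat)
    (x v : nat -> 'I_M -> T -> 'cV[R]_n) (k : 'I_M + 'I_N * 'I_M) :
    T -> 'cV[R]_n :=
  match k with
  | inl i => x 1%N i
  | inr (t, i) => v t.+1 i
  end.

(* Column k of the observation at time t is the noisy state of agent phi_t(k). *)
Definition observation (T : Type) (R : realType) (n M : nat)
    (x v : nat -> 'I_M -> T -> 'cV[R]_n) (permt : nat -> 'S_M)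
    (t : nat) (w : T) : 'M[R]_(n, M) :=
  \matrix_(j, k) (x t (permt t k) w + v t (permt t k) w) j 0.

(* Main.v *)
(* Let L_t(Q, P) be the matrix of the linear inequality at time t, and let u be
   the optimal input.  Telescoping x_t^T P_t x_t along the optimal trajectory
   turns the noiseless objective into the sum over t of
   (u_t, x_t)^T L_t(Q, P) (u_t, x_t) - |u_t|^2, where the first term is
   nonnegative and vanishes at (Qbar, Pbar) by completing the square in the
   Riccati equation.  The noise contributes exactly the trace correction: it is
   centered and independent of x_1.

   At another minimizer the expected first term is zero.  Since the second
   moment of x_1 is positive definite and the closed-loop matrices are
   invertible, L_t(Q, P) vanishes on (u_t, x_t) for every value of x_t.  With
   D_t = P_t - Pbar_t and dQ = Q - Qbar this gives D_t = A^T D_{t+1} A + dQ and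
   B^T D_{t+1} = 0, hence B^T (A^T)^k dQ A^k = 0 for k < n, and controllability
   yields dQ = 0. *)

Require Import Defs.
From HB Require Import structures.
From mathcomp Require Import all_boot all_order all_algebra all_fingroup.
From mathcomp Require Import all_classical all_reals all_analysis.
From mathcomp Require Import measurable_realfun zify ring lra.
Set Implicit Arguments.
Unset Strict Implicit.
Unset Printing Implicit Defensive.
Import Order.TTheory GRing.Theory Num.Theory numFieldNormedType.Exports.
Local Open Scope classical_set_scope.
Local Open Scope ring_scope.

(** * Quadratic forms and semidefinite matrices *)

Section QuadraticForms.
Context {R : realType}.
Implicit Types (p q : nat).

Lemma qformE p (Q : 'M[R]_p) (y : 'cV[R]_p) :
  qform Q y = \sum_j \sum_k Q j k * (y j 0 * y k 0).
Proof.
rewrite /qform mxE exchange_big; apply: eq_bigr => k _ /=.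
rewrite mxE big_distrl /=; apply: eq_bigr => j _.
by rewrite mxE mulrCA mulrA.
Qed.

Lemma bform_tr p q (Q : 'M[R]_(p, q)) (x : 'cV[R]_p) (y : 'cV[R]_q) :
  (y^T *m Q^T *m x) 0 0 = (x^T *m Q *m y) 0 0.
Proof.
by rewrite -[in RHS](trmxK (x^T *m Q *m y)) [RHS]mxE !trmx_mul trmxK mulmxA.
Qed.

Lemma qform_add p (Q : 'M[R]_p) (x y : 'cV[R]_p) :
  qform Q (x + y) = qform Q x + (x^T *m (Q + Q^T) *m y) 0 0 + qform Q y.
Proof.
have E (U V : 'M[R]_1) : (U + V) 0 0 = U 0 0 + V 0 0 by rewrite mxE.
rewrite /qform [(x + y)^T]raddfD /= !mulmxDl !mulmxDr !mulmxDl !E bform_tr.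
by rewrite !addrA.
Qed.

Lemma qform_mul p q (Q : 'M[R]_p) (F : 'M[R]_(p, q)) (x : 'cV[R]_q) :
  qform Q (F *m x) = qform (F^T *m Q *m F) x.
Proof. by rewrite /qform trmx_mul !mulmxA. Qed.

Lemma qform_mxD p (Q S : 'M[R]_p) (x : 'cV[R]_p) :
  qform (Q + S) x = qform Q x + qform S x.
Proof. by rewrite /qform mulmxDr mulmxDl mxE. Qed.

Lemma qform_mxN p (Q : 'M[R]_p) (x : 'cV[R]_p) : qform (- Q) x = - qform Q x.
Proof. by rewrite /qform mulmxN mulNmx mxE. Qed.

Lemma qform_scale p c (Q : 'M[R]_p) (x : 'cV[R]_p) :
  qform Q (c *: x) = c ^+ 2 * qform Q x.
Proof.
by rewrite /qform [(c *: x)^T]linearZ /= -!scalemxAl -scalemxAr !mxE mulrA.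
Qed.

Lemma qform_sum p (I : Type) (s : seq I) (P : pred I) (F : I -> 'M[R]_p)
    (x : 'cV[R]_p) :
  qform (\sum_(i <- s | P i) F i) x = \sum_(i <- s | P i) qform (F i) x.
Proof.
rewrite (big_morph (fun Q => qform Q x) (id1 := 0) (op1 := +%R))//.
  by move=> Q S; exact: qform_mxD.
by rewrite /qform mulmx0 mul0mx mxE.
Qed.

Lemma qform1_ge0 p (x : 'cV[R]_p) : 0 <= (x^T *m x) 0 0.
Proof. by rewrite mxE sumr_ge0// => k _; rewrite mxE -expr2 sqr_ge0. Qed.

Lemma qform1_eq0 p (x : 'cV[R]_p) : (x^T *m x) 0 0 = 0 -> x = 0.
Proof.
rewrite mxE => /eqP; rewrite psumr_eq0 => [/allP x0|k _]; last first.
  by rewrite mxE -expr2 sqr_ge0.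
apply/matrixP => k j; rewrite ord1 [RHS]mxE.
have := x0 k (mem_index_enum k); rewrite mxE -expr2 sqrf_eq0.
by move/eqP.
Qed.

Lemma psdmxD p (Q S : 'M[R]_p) : psdmx Q -> psdmx S -> psdmx (Q + S).
Proof.
move=> [sQ Q0] [sS S0]; split=> [|x]; first by rewrite raddfD /= sQ sS.
by rewrite qform_mxD addr_ge0.
Qed.

Lemma psdmx_congr p q (Q : 'M[R]_p) (F : 'M[R]_(p, q)) :
  psdmx Q -> psdmx (F^T *m Q *m F).
Proof.
move=> [sQ Q0]; split=> [|x]; first by rewrite !trmx_mul trmxK sQ mulmxA.
by rewrite -qform_mul.
Qed.

Lemma psdmx_sum p (I : Type) (s : seq I) (P : pred I) (F : I -> 'M[R]_p) :
  (forall i, P i -> psdmx (F i)) -> psdmx (\sum_(i <- s | P i) F i).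
Proof.
move=> F0; apply: big_ind => //; last exact: psdmxD.
split=> [|x]; first exact: trmx0.
by rewrite /qform mulmx0 mul0mx mxE.
Qed.

(* The discriminant of the nonnegative quadratic polynomial
   [s |-> qform Q (x + s *: y)]. *)
Lemma psdmx_CauchySchwarz p (Q : 'M[R]_p) (x y : 'cV[R]_p) : psdmx Q ->
  ((x^T *m Q *m y) 0 0) ^+ 2 <= qform Q x * qform Q y.
Proof.
move=> [sQ Q0]; set b := (x^T *m Q *m y) 0 0.
have poly s : 0 <= qform Q x + 2 * s * b + s ^+ 2 * qform Q y.
  have := Q0 (x + s *: y); rewrite qform_add qform_scale sQ.
  have -> : (x^T *m (Q + Q) *m (s *: y)) 0 0 = s * (b + b).
    by rewrite -scalemxAr mxE mulmxDr mulmxDl mxE.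
  by congr (0 <= _); ring.
have [y0|y0] := eqVneq (qform Q y) 0.
  rewrite y0 mulr0.
  have [->|b0] := eqVneq b 0; first by rewrite expr0n.
  (* When [qform Q y = 0] the polynomial is affine in [s]; this [s] would give it the value -1. *)
  have := poly (- (qform Q x + 1) / (2 * b)); rewrite y0 mulr0 addr0.
  have -> : 2 * (- (qform Q x + 1) / (2 * b)) * b = - (qform Q x + 1).
    by field; rewrite b0.
  by rewrite opprD addrA subrr sub0r oppr_ge0 ler10.
have y_gt0 : 0 < qform Q y by rewrite lt_def y0 Q0.
have := poly (- b / qform Q y).
have -> : qform Q x + 2 * (- b / qform Q y) * b
     + (- b / qform Q y) ^+ 2 * qform Q y =
   qform Q x - b ^+ 2 / qform Q y by field.
by rewrite subr_ge0 ler_pdivrMr.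
Qed.

(** Cauchy-Schwarz for the pair [Q *m x], [x] bounds the fourth power of |Qx| by a multiple of
    [qform Q x]. *)
Lemma psdmx_qform_eq0 p (Q : 'M[R]_p) (x : 'cV[R]_p) :
  psdmx Q -> qform Q x = 0 -> Q *m x = 0.
Proof.
move=> psdQ Qx0; apply: qform1_eq0.
have [sQ _] := psdQ.
have := psdmx_CauchySchwarz (Q *m x) x psdQ.
rewrite Qx0 mulr0 -mulmxA => le0.
by apply/eqP; rewrite -sqrf_eq0 eq_le sqr_ge0 andbT.
Qed.

Lemma psdmx_eq0 p (Q : 'M[R]_p) : psdmx Q -> (forall x, qform Q x = 0) -> Q = 0.
Proof.
move=> psdQ Q0; apply/matrixP => j k.
have := psdmx_qform_eq0 psdQ (Q0 (delta_mx k 0)).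
by move/matrixP/(_ j 0); rewrite -colE !mxE.
Qed.

Lemma psdmx_sum_eq0 p (I : eqType) (s : seq I) (P : pred I) (F : I -> 'M[R]_p) :
  (forall i, P i -> psdmx (F i)) -> \sum_(i <- s | P i) F i = 0 ->
  forall i, i \in s -> P i -> F i = 0.
Proof.
move=> psdF sumF0 i si Pi; apply: psdmx_eq0 => [|x]; first exact: psdF.
have : \sum_(j <- s | P j) qform (F j) x == 0.
  by rewrite -qform_sum sumF0 /qform mulmx0 mul0mx mxE.
rewrite psumr_eq0 => [/allP/(_ i si)|j /psdF[_]]; last exact.
by rewrite Pi => /eqP.
Qed.

Lemma mulmx_cV_eq0 p q (F : 'M[R]_(p, q)) :
  (forall x : 'cV[R]_q, F *m x = 0) -> F = 0.
Proof.
move=> F0; apply/matrixP => i j.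
by have /matrixP/(_ i 0) := F0 (delta_mx j 0); rewrite -colE !mxE.
Qed.

Lemma pdmx_unit p (Q : 'M[R]_p) : pdmx Q -> Q \in unitmx.
Proof.
move=> [_ Q_gt0]; rewrite -row_free_unit -kermx_eq0; apply/negPn/negP.
move=> /rowV0Pn[y /sub_kermxP yQ y0].
have yT0 : y^T != 0 by apply: contra_neq y0 => yT; rewrite -[y]trmxK yT trmx0.
by have := Q_gt0 _ yT0; rewrite /qform trmxK yQ mul0mx mxE ltxx.
Qed.

Lemma pdmx_psd p (Q : 'M[R]_p) : pdmx Q -> psdmx Q.
Proof.
move=> [sQ Q0]; split=> // x; have [->|/Q0/ltW//] := eqVneq x 0.
by rewrite /qform mulmx0 mxE.
Qed.

End QuadraticForms.

(** * Means, integrability and products of independent variables *)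

Section Moments.
Context {d : measure_display} {T : measurableType d} {R : realType}.
Variable Pr : probability T R.
Implicit Types (f g X Y : T -> R) (a b c : R).

(** Integrability travels with the value because the linearity rules for the expectation ask for
    it. *)
Definition has_mean f a : Prop :=
  Pr.-integrable setT (EFin \o f) /\ 'E_Pr[f]%E = a%:E.

Lemma has_mean_unique f a b : has_mean f a -> has_mean f b -> a = b.
Proof. by move=> [_ Ea] [_ Eb]; apply: EFin_inj; rewrite -Ea -Eb. Qed.

Lemma has_mean_integrable f : Pr.-integrable setT (EFin \o f) ->
  has_mean f (fine 'E_Pr[f]%E).
Proof.
move=> intf; split=> //; rewrite fineK// expectation_fin_num//.
exact/Lfun1_integrable.
Qed.

Lemma has_mean_cst c : has_mean (cst c) c.
Proof.
by split; [exact: finite_measure_integrable_cst|exact: expectation_cst].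
Qed.

Lemma has_meanD f g a b : has_mean f a -> has_mean g b ->
  has_mean (fun w => f w + g w) (a + b).
Proof.
move=> [intf Ef] [intg Eg]; split.
  rewrite (_ : _ \o _ = (EFin \o f) \+ (EFin \o g))%E; last exact/funext.
  exact: integrableD.
by rewrite (expectationD (X := f) (Y := g)) ?Ef ?Eg//; exact/Lfun1_integrable.
Qed.

Lemma has_meanZ c f a : has_mean f a -> has_mean (fun w => c * f w) (c * a).
Proof.
move=> [intf Ef]; split.
  rewrite (_ : _ \o _ = fun w => c%:E * (EFin \o f) w)%E; last exact/funext.
  exact: integrableZl.
rewrite (_ : (fun w => _) = c \o* f).
  by rewrite expectationZl ?Ef//; exact/Lfun1_integrable.
by apply/funext => w /=; rewrite mulrC.
Qed.

Lemma has_mean_eq f g a b : f =1 g -> a = b -> has_mean f a -> has_mean g b.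
Proof. by move=> /funext -> ->. Qed.

Lemma has_meanN f a : has_mean f a -> has_mean (fun w => - f w) (- a).
Proof.
move=> /(has_meanZ (-1)); apply: has_mean_eq => [w|]; exact: mulN1r.
Qed.

Lemma has_mean_sum (I : Type) (s : seq I) (p : pred I) (F : I -> T -> R)
    (e : I -> R) : (forall i, p i -> has_mean (F i) (e i)) ->
  has_mean (fun w => \sum_(i <- s | p i) F i w) (\sum_(i <- s | p i) e i).
Proof.
move=> HF; elim: s => [|i s IH].
  by apply: has_mean_eq (has_mean_cst 0) => [w|]; rewrite big_nil.
rewrite big_cons; case: ifPn => [pi|/negPf npi].
  by apply: has_mean_eq (has_meanD (HF i pi) IH) => // w; rewrite big_cons pi.
by apply: has_mean_eq IH => // w; rewrite big_cons npi.
Qed.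

Lemma has_mean_sum_nat m n (F : nat -> T -> R) (e : nat -> R) :
  (forall t, (m <= t < n)%N -> has_mean (F t) (e t)) ->
  has_mean (fun w => \sum_(m <= t < n) F t w) (\sum_(m <= t < n) e t).
Proof.
move=> HF.
apply: has_mean_eq (has_mean_sum (index_iota m n) HF) => [w|];
  by rewrite [RHS]big_nat.
Qed.

Lemma has_mean_ge0 f a : has_mean f a -> (forall w, 0 <= f w) -> 0 <= a.
Proof. by move=> [_ Ef] f0; rewrite -lee_fin -Ef expectation_ge0. Qed.

(** Domination: |XY| is at most X^2 + Y^2. *)
Lemma integrable_mul_of_sqr X Y :
  measurable_fun setT X -> measurable_fun setT Y ->
  Pr.-integrable setT (EFin \o (fun w => X w * X w)) ->
  Pr.-integrable setT (EFin \o (fun w => Y w * Y w)) ->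
  Pr.-integrable setT (EFin \o (fun w => X w * Y w)).
Proof.
move=> mX mY iX iY.
apply: (@le_integrable _ _ _ _ _ _ _
  (EFin \o (fun w => X w * X w + Y w * Y w))) => //.
- exact/measurable_EFinP/measurable_funM.
- move=> w _ /=; rewrite lee_fin [leRHS]ger0_norm; last by nra.
  by rewrite ler_norml; apply/andP; split; nra.
- rewrite (_ : _ \o _ =
    ((EFin \o (fun w => (X w * X w)%R))
     \+ (EFin \o (fun w => (Y w * Y w)%R)))%E).
    exact: integrableD.
  exact/funext.
Qed.

Lemma integrable_of_sqr X : measurable_fun setT X ->
  Pr.-integrable setT (EFin \o (fun w => X w * X w)) ->
  Pr.-integrable setT (EFin \o X).
Proof.
move=> mX iX.
have := integrable_mul_of_sqr (Y := cst 1) mX _ iX _.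
have -> : (fun w => X w * cst 1 w) = X by apply/funext => w; rewrite mulr1.
apply; first exact: measurable_cst.
by have [] := has_mean_cst (1 * 1).
Qed.

(** By independence the law of the pair agrees with the product of the two laws on rectangles, hence
    on all measurable sets; Fubini then factors the integral. *)
Lemma has_mean_mul_indep (X Y : {RV Pr >-> R}) a b :
  (forall C D, measurable C -> measurable D ->
     Pr (X @^-1` C `&` Y @^-1` D) = (Pr (X @^-1` C) * Pr (Y @^-1` D))%E) ->
  has_mean X a -> has_mean Y b ->
  Pr.-integrable setT (EFin \o (fun w => X w * Y w)) ->
  has_mean (fun w => X w * Y w) (a * b).
Proof.
move=> indXY [iX EX] [iY EY] iXY; split=> //.
pose XY w := (X w, Y w).
have mXY : measurable_fun setT XY by exact/measurable_fun_pair.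
pose f (z : R * R) : \bar R := (z.1 * z.2)%:E.
have mf : measurable_fun setT f.
  by apply/measurable_EFinP; apply: measurable_funM.
pose mX := distribution Pr X; pose mY := distribution Pr Y.
have eqm C : measurable C -> (mX \x mY)%E C = pushforward Pr XY C.
  apply: (product_measure_unique (m1 := mX) (m2 := mY)
    (m' := [the measure _ _ of pushforward Pr XY])).
  by move=> C1 C2 mC1 mC2; rewrite /= /pushforward/= indXY.
have iXY' : (mX \x mY)%E.-integrable setT f.
  apply/integrableP; split=> //.
  rewrite (eq_measure_integral [the measure _ _ of pushforward Pr XY]);
    last first.
    by move=> C mC _; exact: eqm.
  by have /integrableP[] := integrable_pushforward mXY mf iXY measurableT.
rewrite unlock.
transitivity (\int[pushforward Pr XY]_z f z)%E.
  by rewrite integral_pushforward.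
transitivity (\int[mX \x mY]_z f z)%E.
  by apply: eq_measure_integral => C mC _; rewrite [RHS]eqm.
rewrite -integral12_prod_meas1// /fubini_F /f /=.
transitivity (\int[mX]_x (x%:E * b%:E))%E.
  apply: eq_integral => x _.
  under eq_integral do rewrite EFinM.
  rewrite integralZl//; last first.
    by apply: integrable_pushforward => //; exact/measurable_EFinP.
  rewrite integral_distribution//.
  by rewrite -EY unlock.
rewrite integralZr//; last first.
  by apply: integrable_pushforward => //; exact/measurable_EFinP.
rewrite integral_distribution//.
by rewrite EFinM -EX unlock.
Qed.

End Moments.

(** * Second moments of random vectors *)

Section RandomVectorMoments.
Context {d : measure_display} {T : measurableType d} {R : realType} {n : nat}.
Variable Pr : probability T R.
Implicit Types (X Y : T -> 'cV[R]_n).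

(** Coordinates are continuous. This transfers measurability and independence from vectors to their
    real coordinates. *)
Lemma borel_cV_coord (j : 'I_n) (C : set R) : measurable C ->
  borel_cV [set y : 'cV[R]_n | C (y j 0)].
Proof.
move=> mC.
pose V := g_sigma_algebraType [set U : set 'cV[R]_n | open U].
pose f (y : V) : R := (y : 'cV[R]_n) j 0.
have mf : measurable_fun setT f.
  apply: (measurability _ (RGenOpens.measurableE R)) => _ [_ [a [b ->]] <-].
  rewrite setTI; apply: sub_sigma_algebra => /=.
  apply: (open_comp (f := fun y : 'cV[R]_n => y j 0)) => //.
  by move=> y _; exact: coord_continuous.
by have := mf measurableT C mC; rewrite setTI.
Qed.

Lemma measurable_coord X j : random_vector X ->
  measurable_fun setT (fun w => X w j 0).
Proof.
move=> rX _ C mC; rewrite setTI.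
exact: (rX _ (borel_cV_coord j mC)).
Qed.

Definition second_moment X (S : 'M[R]_n) : Prop :=
  forall j k, has_mean Pr (fun w => X w j 0 * X w k 0) (S j k).

(** The Frobenius inner product tr(W^T S). When [S] is the second moment of a random vector, it is
    the mean of the form [W] at that vector. *)
Definition entry_sum (W S : 'M[R]_n) : R := \sum_j \sum_k W j k * S j k.

Lemma mean_qform X S (W : 'M[R]_n) : second_moment X S ->
  has_mean Pr (fun w => qform W (X w)) (entry_sum W S).
Proof.
move=> mX.
apply: (has_mean_eq (f := fun w => \sum_j \sum_k W j k * (X w j 0 * X w k 0))).
- by move=> w; rewrite qformE.
- by [].
by do 2 apply: has_mean_sum => ? _; exact: has_meanZ.
Qed.

Definition uncorrelated X Y : Prop :=
  forall j k, has_mean Pr (fun w => X w j 0 * Y w k 0) 0.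

(** In the expanded form the cross term has mean zero and the pure noise term has mean tr(W Sigma),
    so the corrected form has the mean of its noiseless counterpart. *)
Lemma mean_qform_noise X v S Sigma Phi (W : 'M[R]_n) :
  second_moment X S -> second_moment v Sigma -> uncorrelated X v ->
  Sigma^T = Sigma ->
  has_mean Pr (fun w => qform W (Phi *m X w + v w) - \tr (W *m Sigma))
    (entry_sum (Phi^T *m W *m Phi) S).
Proof.
move=> mX mv Xv symS.
pose C := Phi^T *m (W + W^T).
apply: (has_mean_eq (f := fun w => qform (Phi^T *m W *m Phi) (X w)
   + \sum_j \sum_k C j k * (X w j 0 * v w k 0)
   + qform W (v w) + - \tr (W *m Sigma)) (a := _ + _ + _ + - _)); first last.
- apply: has_meanD; last exact: (has_mean_cst _ (- _)).
  apply: has_meanD; last exact: mean_qform mv.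
  apply: has_meanD; first exact: mean_qform mX.
  by do 2 apply: has_mean_sum => ? _; apply: has_meanZ; exact: Xv.
- rewrite [X in _ + X + _ + _](_ : _ = 0) ?addr0; last first.
    by rewrite big1// => j _; rewrite big1// => k _; rewrite mulr0.
  rewrite [X in _ - X](_ : _ = entry_sum W Sigma) ?addrK//.
  rewrite /mxtrace; apply: eq_bigr => j _; rewrite mxE; apply: eq_bigr => k _.
  by rewrite -{1}symS mxE.
- move=> w; congr (_ + _).
  rewrite qform_add qform_mul trmx_mul; congr (_ + _ + _).
  rewrite -(mulmxA (X w)^T) mxE exchange_big; apply: eq_bigr => k _ /=.
  rewrite mxE big_distrl /=; apply: eq_bigr => j _.
  by rewrite [(X w)^T 0 j]mxE mulrCA mulrA.
Qed.

Lemma second_moment_sqr X : random_vector X ->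
  (forall j, Pr.-integrable setT (EFin \o (fun w => X w j 0 * X w j 0))) ->
  second_moment X (\matrix_(j, k) fine 'E_Pr[fun w => (X w j 0 * X w k 0)%R]%E).
Proof.
move=> rX iX j k; rewrite mxE; apply: has_mean_integrable.
by apply: integrable_mul_of_sqr => //; exact: measurable_coord.
Qed.

Lemma integrable_coord_sqr X : random_vector X ->
  ('E_Pr[fun w => (frobenius (X w) ^+ 2)%R] < +oo)%E ->
  forall j, Pr.-integrable setT (EFin \o (fun w => X w j 0 * X w j 0)).
Proof.
move=> rX fX j; have mX k := measurable_coord k rX.
have frobE w : frobenius (X w) ^+ 2 = \sum_k X w k 0 * X w k 0.
  rewrite sqr_sqrtr; last by do 2 apply: sumr_ge0 => ? _; exact: sqr_ge0.
  by apply: eq_bigr => k _; rewrite big_ord1 expr2.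
apply: (@le_integrable _ _ _ _ _ _ _
  (EFin \o (fun w => frobenius (X w) ^+ 2))) => //.
- exact/measurable_EFinP/measurable_funM.
- move=> w _ /=; rewrite lee_fin !ger0_norm ?sqr_ge0 -?expr2 ?sqr_ge0// frobE.
  by rewrite (bigD1 j)//= -expr2 lerDl sumr_ge0// => k _; rewrite -expr2 sqr_ge0.
- apply/integrableP; split.
    apply/measurable_EFinP.
    rewrite (_ : (fun w => _) = fun w => \sum_k X w k 0 * X w k 0).
      by apply: measurable_sum => k; exact: measurable_funM.
    by apply/funext => w; rewrite frobE.
  move: fX; rewrite unlock; congr (_ < _)%E; apply: eq_integral => w _ /=.
  by rewrite ger0_norm ?sqr_ge0.
Qed.

Lemma uncorrelated_indep X v S Sigma : random_vector X -> random_vector v ->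
  (forall C D, borel_cV C -> borel_cV D ->
     Pr (X @^-1` C `&` v @^-1` D) = (Pr (X @^-1` C) * Pr (v @^-1` D))%E) ->
  second_moment X S -> second_moment v Sigma ->
  (forall k, 'E_Pr[fun w => (v w k 0)%R]%E = 0%E) ->
  uncorrelated X v.
Proof.
move=> rX rv ind mX mv v0 j k.
have mXj := measurable_coord j rX; have mvk := measurable_coord k rv.
have iX := integrable_of_sqr mXj (mX j j).1.
have iv := integrable_of_sqr mvk (mv k k).1.
pose X' : {RV Pr >-> R} := mfun_Sub (mem_set mXj : _ \in mfun).
pose v' : {RV Pr >-> R} := mfun_Sub (mem_set mvk : _ \in mfun).
have := @has_mean_mul_indep _ _ _ Pr X' v'
  (fine 'E_Pr[fun w => (X w j 0)%R]%E) 0.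
rewrite mulr0; apply.
- move=> C D mC mD.
  exact: (ind _ _ (borel_cV_coord j mC) (borel_cV_coord k mD)).
- exact: has_mean_integrable.
- by split=> //; exact: v0.
- apply: integrable_mul_of_sqr => //; [exact: (mX j j).1|exact: (mv k k).1].
Qed.

(** For a centered vector, covariances are plain second moments. A finite diagonal entry makes the
    nonnegative square of that coordinate integrable, and the mixed products follow. *)
Lemma second_moment_centered v Sigma : random_vector v ->
  (forall k, 'E_Pr[fun w => (v w k 0)%R]%E = 0%E) ->
  covmx Pr v = map_mx EFin Sigma -> second_moment v Sigma.
Proof.
move=> rv v0 cov.
have covE j k : 'E_Pr[fun w => (v w j 0 * v w k 0)%R]%E = (Sigma j k)%:E.
  transitivity (covmx Pr v j k); last by rewrite cov mxE.
  rewrite mxE covariance.unlock !v0 /=; congr expectation.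
  by apply/funext => w; rewrite !fctE /= !subr0.
have mv k := measurable_coord k rv.
have isqr j : Pr.-integrable setT (EFin \o (fun w => v w j 0 * v w j 0)).
  apply/integrableP; split; first exact/measurable_EFinP/measurable_funM.
  have := covE j j; rewrite unlock => h.
  rewrite (_ : integral _ _ _ = (Sigma j j)%:E) ?ltry// -h.
  by apply: eq_integral => w _ /=; rewrite ger0_norm// -expr2 sqr_ge0.
by move=> j k; split=> //; exact: integrable_mul_of_sqr.
Qed.

(** The second moment is the covariance plus the outer product of the mean with itself, and the
    latter can only increase the form. *)
Lemma qform_second_moment_gt0 X S (c : 'cV[R]_n) : random_vector X ->
  second_moment X S -> pdmx (map_mx fine (covmx Pr X)) -> c != 0 ->
  0 < qform S c.
Proof.
move=> rX mX [_ cov_gt0] c0; apply: (lt_le_trans (cov_gt0 _ c0)).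
pose mu : 'cV[R]_n := \col_j fine 'E_Pr[fun w => (X w j 0)%R]%E.
have iX j : Pr.-integrable setT (EFin \o (fun w => X w j 0)).
  by apply: integrable_of_sqr; [exact: measurable_coord|exact: (mX j j).1].
rewrite (_ : S = map_mx fine (covmx Pr X) + mu *m mu^T).
  rewrite qform_mxD lerDl /qform mulmxA -mulmxA.
  rewrite (_ : c^T *m mu = (mu^T *m c)^T) ?qform1_ge0//.
  by rewrite trmx_mul trmxK.
apply/matrixP => j k; rewrite !mxE big_ord1 !mxE covarianceE.
- rewrite (mX j k).2 fineB ?fineM//= ?fin_numM//.
  + by rewrite subrK.
  1-4: apply: expectation_fin_num; exact/Lfun1_integrable.
- exact/Lfun1_integrable.
- exact/Lfun1_integrable.
- exact/Lfun1_integrable/(mX j k).1.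
Qed.

(* By Cauchy-Schwarz [qform W x >= ((W e_j)^T x)^2 / W j j], and the right-hand
   side has positive mean unless [W e_j = 0]. *)
Lemma psdmx_mean0_eq0 X S W : random_vector X -> second_moment X S ->
  pdmx (map_mx fine (covmx Pr X)) -> psdmx W ->
  has_mean Pr (fun w => qform W (X w)) 0 -> W = 0.
Proof.
move=> rX mX cov psdW E0; have [sW W0] := psdW.
apply/matrixP => i j; rewrite [RHS]mxE.
pose e : 'cV[R]_n := delta_mx j 0.
suff We0 : W *m e = 0 by move/matrixP/(_ i 0): We0; rewrite -colE !mxE.
apply/eqP/negPn/negP => We0.
have := qform_second_moment_gt0 rX mX cov We0; apply/negP; rewrite -leNgt.
pose D := (W *m e) *m (W *m e)^T.
have DE x : qform D x = ((x^T *m W *m e) 0 0) ^+ 2.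
  rewrite /qform /D trmx_mul sW !mulmxA -2!(mulmxA (x^T *m W *m e)).
  rewrite mxE big_ord1.
  rewrite expr2; congr (_ * _); rewrite -[in RHS]sW.
  by rewrite -bform_tr !trmxK.
have mD : has_mean Pr (fun w => qform D (X w)) (qform S (W *m e)).
  apply: has_mean_eq (mean_qform D mX) => //.
  rewrite qformE; apply: eq_bigr => k _; apply: eq_bigr => l _.
  by rewrite mulrC; congr (_ * _); rewrite [LHS]mxE big_ord1 [_^T 0 l]mxE.
(* The variable [qform W e * qform W x - qform D x] is nonnegative and has mean
   [- qform S (W *m e)], which is therefore nonnegative too. *)
have := has_meanD (has_meanZ (qform W e) E0) (has_meanZ (-1) mD).
move/has_mean_ge0; rewrite mulr0 add0r mulN1r oppr_ge0; apply=> w.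
rewrite mulN1r subr_ge0 DE mulrC; exact: psdmx_CauchySchwarz.
Qed.

End RandomVectorMoments.

(** * One Riccati step and its linear matrix inequality *)

Section Riccati.
Context {R : realType} {n m : nat}.
Variables (A : 'M[R]_n) (B : 'M[R]_(n, m)).
Implicit Types (P Pn Q : 'M[R]_n).

Definition input_weight Pn : 'M[R]_m := B^T *m Pn *m B + 1%:M.

Definition gain Pn : 'M[R]_(m, n) :=
  invmx (input_weight Pn) *m B^T *m Pn *m A.

Definition closed_loop Pn : 'M[R]_n := A - B *m gain Pn.

Definition riccati_step Q Pn : 'M[R]_n :=
  A^T *m Pn *m A + Q
  - A^T *m Pn *m B *m invmx (input_weight Pn) *m B^T *m Pn *m A.

Lemma qform_riccati_lmi Q Pn P (u : 'cV[R]_m) (x : 'cV[R]_n) :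
  qform (riccati_lmi A B Q Pn P) (col_mx u x) =
  qform Pn (A *m x + B *m u) + qform Q x - qform P x + (u^T *m u) 0 0.
Proof.
have E (U V : 'M[R]_1) : (U + V) 0 0 = U 0 0 + V 0 0 by rewrite mxE.
have EN (U : 'M[R]_1) : (- U) 0 0 = - U 0 0 by rewrite mxE.
rewrite /qform /riccati_lmi tr_col_mx mul_row_block mul_row_col.
rewrite [(A *m x + _)^T]raddfD /= !trmx_mul.
rewrite !(mulmxDr, mulmxDl, mulmxN, mulNmx, mulmx1) !mulmxA !E !EN.
ring.
Qed.

Lemma input_weight_pd Pn : psdmx Pn -> pdmx (input_weight Pn).
Proof.
move=> [sP P0]; split=> [|u u0].
  by rewrite /input_weight raddfD /= !trmx_mul trmxK sP trmx1 mulmxA.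
rewrite qform_mxD -qform_mul ltr_wpDl// /qform mulmx1 lt_def qform1_ge0 andbT.
by apply: contra_neq u0 => /qform1_eq0.
Qed.

Lemma gainE Pn : psdmx Pn -> input_weight Pn *m gain Pn = B^T *m Pn *m A.
Proof.
by move=> /input_weight_pd/pdmx_unit uW; rewrite /gain !mulmxA mulmxV// mul1mx.
Qed.

(** Completing the square: at the Riccati step the Schur complement of the input block is zero. *)
Lemma riccati_lmi_factor Q Pn : psdmx Pn ->
  riccati_lmi A B Q Pn (riccati_step Q Pn) =
  (row_mx 1%:M (gain Pn))^T *m input_weight Pn *m row_mx 1%:M (gain Pn).
Proof.
move=> psdP; have [sP _] := psdP; have [sW _] := input_weight_pd psdP.
have WK := gainE psdP.
have KW : (gain Pn)^T *m input_weight Pn = A^T *m Pn *m B.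
  by rewrite -{1}sW -trmx_mul WK !trmx_mul trmxK sP mulmxA.
rewrite tr_row_mx trmx1 mul_col_mx mul1mx KW mul_col_row !mulmx1 WK.
rewrite /riccati_lmi /riccati_step; congr block_mx.
by rewrite opprB addrC subrK /gain !mulmxA.
Qed.

Lemma qform_riccati_lmi_step Q Pn (u : 'cV[R]_m) (x : 'cV[R]_n) : psdmx Pn ->
  qform (riccati_lmi A B Q Pn (riccati_step Q Pn)) (col_mx u x) =
  qform (input_weight Pn) (u + gain Pn *m x).
Proof.
by move=> psdP; rewrite riccati_lmi_factor// -qform_mul mul_row_col mul1mx.
Qed.

Lemma riccati_lmi_step_psd Q Pn : psdmx Pn ->
  psdmx (riccati_lmi A B Q Pn (riccati_step Q Pn)).
Proof.
move=> psdP; rewrite riccati_lmi_factor//.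
exact/psdmx_congr/pdmx_psd/input_weight_pd.
Qed.

Lemma riccati_step_psd Q Pn : psdmx Q -> psdmx Pn -> psdmx (riccati_step Q Pn).
Proof.
move=> [sQ Q0] psdP; have [sP P0] := psdP; have [sW _] := input_weight_pd psdP.
split=> [|x].
  rewrite /riccati_step !(raddfD, raddfN) /= !trmx_mul !trmxK trmx_inv.
  by rewrite sW sP sQ !mulmxA.
(* This input annuls the completed square, so the form of the Riccati step at [x] becomes a sum of
   three nonnegative terms. *)
pose u := - (gain Pn *m x).
have := qform_riccati_lmi Q Pn (riccati_step Q Pn) u x.
rewrite qform_riccati_lmi_step// addNr {1}/qform mulmx0 mxE => /esym/eqP.
rewrite addrAC subr_eq0 => /eqP <-.
by rewrite !addr_ge0// qform1_ge0.
Qed.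

Lemma gain_closed_loop Pn : psdmx Pn ->
  gain Pn = B^T *m Pn *m closed_loop Pn.
Proof.
move=> psdP; rewrite mulmxBr -gainE// /input_weight mulmxDl mul1mx.
by rewrite !mulmxA addrC addKr.
Qed.

(** By [gain_closed_loop], multiplying the closed loop by I + B B^T Pn gives back [A]; square
    factors of an invertible matrix are invertible. *)
Lemma closed_loop_unit Pn : A \in unitmx -> psdmx Pn ->
  closed_loop Pn \in unitmx.
Proof.
move=> uA psdP.
have : (1%:M + B *m B^T *m Pn) *m closed_loop Pn \in unitmx.
  rewrite mulmxDl mul1mx -!mulmxA [B^T *m _]mulmxA -gain_closed_loop//.
  by rewrite subrK.
by rewrite unitmx_mul => /andP[].
Qed.

(** Input stacked over state, in the block order of [riccati_lmi]. *)
Definition feedback Pn : 'M[R]_(m + n, n) := col_mx (- gain Pn) 1%:M.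

Lemma feedback_mul Pn (x : 'cV[R]_n) :
  feedback Pn *m x = col_mx (- (gain Pn *m x)) x.
Proof. by rewrite mul_col_mx mul1mx mulNmx. Qed.

Lemma closed_loop_mul Pn (x : 'cV[R]_n) :
  closed_loop Pn *m x = A *m x + B *m (- (gain Pn *m x)).
Proof. by rewrite mulmxN mulmxA -mulmxBl. Qed.

(** These are the two block rows of the equation. With [Pb] fixed both are affine in [Q], [Pn] and
    [P], so they can be subtracted for two solutions. *)
Lemma riccati_lmi_feedback0 Pb Q Pn P :
  riccati_lmi A B Q Pn P *m feedback Pb = 0 ->
  gain Pb = B^T *m Pn *m closed_loop Pb /\
  P = A^T *m Pn *m closed_loop Pb + Q.
Proof.
rewrite mul_block_col !mulmx1 !mulmxN -[RHS]vsubmxK => /eq_col_mx[].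
rewrite !linear0 mulmxDl mul1mx => /eqP + /eqP.
rewrite addrC subr_eq0 => /eqP e1.
rewrite addrA subr_eq0 => /eqP <-; split.
  by rewrite mulmxBr (mulmxA _ B) e1 addrC addKr.
by rewrite mulmxBr (mulmxA _ B) addrC addrAC.
Qed.

Lemma riccati_step_feedback0 Q Pn : psdmx Pn ->
  riccati_lmi A B Q Pn (riccati_step Q Pn) *m feedback Pn = 0.
Proof.
move=> psdP; rewrite riccati_lmi_factor// -mulmxA mul_row_col.
by rewrite mulmx1 mul1mx addNr mulmx0.
Qed.

End Riccati.

(** * Powers of [A], controllability and uniqueness of the weight *)

Section Identifiability.
Context {R : realType} {n m : nat}.
Variables (A : 'M[R]_n) (B : 'M[R]_(n, m)).

Fixpoint mxpow (k : nat) : 'M[R]_n :=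
  if k is k'.+1 then mxpow k' *m A else 1%:M.

Lemma mxpow_unit k : A \in unitmx -> mxpow k \in unitmx.
Proof.
move=> uA; elim: k => [|k IH]; first exact: unitmx1.
by rewrite unitmx_mul IH.
Qed.

End Identifiability.

Lemma mxpow_exp (R : realType) n (A : 'M[R]_n.+1) k : mxpow A k = A ^+ k.
Proof. by elim: k => //= k ->; rewrite exprSr. Qed.

(** By Cayley-Hamilton, A^k is the value at [A] of the remainder of X^k modulo the characteristic
    polynomial, a combination of powers below [n]. *)
Lemma mulmx_mxpow_eq0 (R : realType) n q (A : 'M[R]_n) (B : 'M[R]_(n, q))
    (Z : 'M[R]_n) :
  (forall k, (k < n)%N -> Z *m mxpow A k *m B = 0) ->
  forall k, Z *m mxpow A k *m B = 0.
Proof.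
case: n A B Z => [|n] A B Z ZAB k; first by rewrite [Z]flatmx0 !mul0mx.
have chi0 : char_poly A != 0 by rewrite -size_poly_gt0 size_char_poly.
pose r := 'X^k %% char_poly A.
have size_r : (size r <= n.+1)%N.
  by have := ltn_modp 'X^k (char_poly A); rewrite chi0 size_char_poly ltnS.
have -> : mxpow A k = \sum_(i < size r) r`_i *: mxpow A i.
  rewrite mxpow_exp -[in LHS](horner_mx_X A) -rmorphXn /=.
  rewrite (divp_eq 'X^k (char_poly A)) -/r rmorphD rmorphM /=.
  rewrite Cayley_Hamilton mulr0 add0r -[r in LHS]coefK poly_def rmorph_sum.
  apply: eq_bigr => i _ /=; rewrite linearZ /= rmorphXn /= horner_mx_X.
  by rewrite mxpow_exp.
rewrite mulmx_sumr mulmx_suml big1// => i _.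
by rewrite -scalemxAr -scalemxAl ZAB ?scaler0// (leq_trans (ltn_ord i)).
Qed.

Lemma controllable_annihilator (R : realType) n m (A : 'M[R]_n)
    (B : 'M[R]_(n, m)) (Z : 'M[R]_n) : controllable A B ->
  (forall k, Z *m mxpow A k *m B = 0) -> Z = 0.
Proof.
move=> ctrl ZAB; apply: mulmx_cV_eq0 => b.
have [k [x [u [x0 <- dyn]]]] := ctrl 0 b.
(* The claim covers all [s] because one step of the dynamics trades A^s for A^(s+1). *)
suff reach j : (j <= k)%N -> forall s, Z *m mxpow A s *m x j = 0.
  by have := reach k (leqnn k) 0%N; rewrite mulmx1.
elim: j => [_ s|j IH jk s]; first by rewrite x0 mulmx0.
rewrite dyn// mulmxDr !mulmxA ZAB mul0mx addr0 -(mulmxA Z).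
exact: (IH (ltnW jk) s.+1).
Qed.

(** Going back from time [N], consecutive [D] differ by F_k = (A^T)^k dQ A^k, so B^T kills F_k
    whenever k + 1 < N; since n < N this covers all k < n. Cancelling the right factor A^k leaves
    B^T (A^T)^k dQ = 0, and controllability applies to the transpose of [dQ]. *)
Lemma input_orthogonal_eq0 (R : realType) n m N (A : 'M[R]_n)
    (B : 'M[R]_(n, m)) (D : nat -> 'M[R]_n) (dQ : 'M[R]_n) :
  A \in unitmx -> controllable A B -> (n < N)%N -> D N = dQ ->
  (forall t, (1 <= t < N)%N -> D t = A^T *m D t.+1 *m A + dQ) ->
  (forall t, (1 <= t < N)%N -> B^T *m D t.+1 = 0) ->
  dQ = 0.
Proof.
move=> uA ctrl nN DN Dstep BD.
pose F k := (mxpow A k)^T *m dQ *m mxpow A k.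
have FS k : F k.+1 = A^T *m F k *m A by rewrite /F /= trmx_mul !mulmxA.
have F0 : F 0%N = dQ by rewrite /F /= trmx1 mul1mx mulmx1.
have DF k : (k.+1 < N)%N -> D (N - k.+1)%N = D (N - k)%N + F k.+1.
  have step j : (j.+1 < N)%N ->
      D (N - j.+1)%N = A^T *m D (N - j)%N *m A + dQ.
    move=> jN; rewrite Dstep ?subn_gt0 ?jN ?ltn_subrL ?(ltn_trans _ jN)//.
    by rewrite -subSn// ltnW.
  elim: k => [|k IH] kN; rewrite step//.
    by rewrite subn0 DN addrC FS F0.
  rewrite IH ?(ltnW kN)// mulmxDr mulmxDl -FS addrAC; congr (_ + _).
  by rewrite -IH ?(ltnW kN)// step// (ltnW kN).
have BDk k : (k.+1 < N)%N -> B^T *m D (N - k)%N = 0.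
  move=> kN; have := BD (N - k.+1)%N.
  rewrite -subSn ?(ltnW kN)// subSS; apply.
  by apply/andP; split; lia.
have BF k : (k.+1 < N)%N -> B^T *m F k = 0.
  case: k => [|k] kN; first by have := BDk 0%N kN; rewrite subn0 DN F0.
  have := BDk k.+1 kN; rewrite DF ?(ltnW kN)// mulmxDr BDk ?(ltnW kN)//.
  by rewrite add0r.
apply: trmx_inj; rewrite trmx0.
apply: (controllable_annihilator ctrl); apply: mulmx_mxpow_eq0 => k kn.
apply: trmx_inj; rewrite trmx0 !trmx_mul trmxK mulmxA.
apply: (can_inj (mulmxK (mxpow_unit k uA))).
by rewrite mul0mx -[RHS](BF k) ?(leq_ltn_trans _ nN)// /F !mulmxA.
Qed.

(** * Optimal trajectories and the closed loop *)

Section Trajectories.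
Context {R : realType} {n m : nat}.
Variables (A : 'M[R]_n) (B : 'M[R]_(n, m)) (N : nat).
Hypothesis N_gt0 : (0 < N)%N.
Implicit Types (Q : 'M[R]_n) (P : nat -> 'M[R]_n).

(** [P] is arbitrary so that the identity serves twice: with the Riccati solution it evaluates the
    control cost, with any candidate it evaluates the objective. *)
Lemma lq_cost_telescope Q P x (u : nat -> 'cV[R]_m) : dynamics A B 1 N x u ->
  - qform (P 1%N) (x 1%N) + qform (P N) (x N)
  + \sum_(1 <= t < N) qform Q (x t) =
  \sum_(1 <= t < N) (qform (riccati_lmi A B Q (P t.+1) (P t))
                       (col_mx (u t) (x t)) - ((u t)^T *m u t) 0 0).
Proof.
move=> dyn; rewrite [_ + qform _ (x N)]addrC.
rewrite -(telescope_sumr (fun t => qform (P t) (x t)))//.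
rewrite -big_split; apply: eq_big_nat => t tN /=.
by rewrite qform_riccati_lmi -dyn// addrK addrAC.
Qed.

Section Optimal.
Variables (Q : 'M[R]_n) (P : nat -> 'M[R]_n).
Hypothesis psdQ : psdmx Q.
Hypothesis ricP : riccati A B Q N P.

Lemma riccati_psd t : (1 <= t <= N)%N -> psdmx (P t).
Proof.
have [PN Pstep] := ricP.
move=> /andP[t0 tN]; rewrite -(subKn tN).
have : (N - t < N)%N by rewrite ltn_subrL t0 N_gt0.
elim: (N - t)%N => [|s IH] sN; first by rewrite subn0 PN.
rewrite Pstep ?subn_gt0 ?sN ?ltn_subrL ?N_gt0//.
apply: riccati_step_psd => //; rewrite -subSn ?subSS; last exact: ltnW.
exact/IH/ltnW.
Qed.

Lemma riccati_next_psd t : (1 <= t < N)%N -> psdmx (P t.+1).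
Proof. by move=> /andP[_ tN]; exact: riccati_psd. Qed.

Lemma lq_cost_riccati x (u : nat -> 'cV[R]_m) : dynamics A B 1 N x u ->
  lq_cost Q N x u = qform (P 1%N) (x 1%N)
  + \sum_(1 <= t < N) qform (input_weight B (P t.+1))
                            (u t + gain A B (P t.+1) *m x t).
Proof.
move=> dyn; have [PN Pstep] := ricP.
have := lq_cost_telescope Q P dyn; rewrite PN.
rewrite [RHS](eq_big_nat _ _ (F2 := fun t => qform (input_weight B (P t.+1))
  (u t + gain A B (P t.+1) *m x t) - ((u t)^T *m u t) 0 0)); last first.
  move=> t tN; rewrite (Pstep t tN : _ = riccati_step A B Q (P t.+1)).
  by rewrite qform_riccati_lmi_step//; exact: riccati_next_psd.
rewrite sumrB => /(canLR (subrK _)) <-.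
by rewrite /lq_cost big_split /= -!addrA addNKr.
Qed.

(* Maps the state at time [1] to the optimal state at time [s.+1]. *)
Fixpoint transition (s : nat) : 'M[R]_n :=
  if s is s'.+1 then closed_loop A B (P s'.+2) *m transition s' else 1%:M.

Lemma transition_unit s : A \in unitmx -> (s < N)%N -> transition s \in unitmx.
Proof.
move=> uA; elim: s => [_|s IH sN]; first exact: unitmx1.
by rewrite unitmx_mul closed_loop_unit ?IH ?(ltnW sN)//; exact: riccati_psd.
Qed.

Lemma feedback_transition x :
  dynamics A B 1 N x (fun t => - (gain A B (P t.+1) *m x t)) ->
  forall s, (s < N)%N -> x s.+1 = transition s *m x 1%N.
Proof.
move=> dyn; elim=> [_|s IH sN]; first by rewrite mul1mx.
by rewrite dyn// -closed_loop_mul IH ?(ltnW sN)//= mulmxA.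
Qed.

(** By [lq_cost_riccati] the input affects only the weighted squares of u_t + K_t x_t. Feedback
    makes them all zero, so an optimal input does too, and the positive definite weights force u_t =
    - K_t x_t. *)
Lemma optimal_trajectory_feedback x1 x : optimal_trajectory A B Q N x1 x ->
  dynamics A B 1 N x (fun t => - (gain A B (P t.+1) *m x t)).
Proof.
move=> [u [x1E dyn opt]].
(* The closed-loop competitor; the shift is there because [transition s] ends at time [s.+1]. *)
pose y t := transition t.-1 *m x1.
have dyny : dynamics A B 1 N y (fun t => - (gain A B (P t.+1) *m y t)).
  by move=> [//|t] tN; rewrite -closed_loop_mul mulmxA.
have := opt y _ (mul1mx x1) dyny.
rewrite !lq_cost_riccati// x1E [y 1%N]mul1mx lerD2l.
rewrite [leRHS]big1 => [|t _]; last by rewrite addNr /qform mulmx0 mxE.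
have W_pd t : (1 <= t < N)%N -> pdmx (input_weight B (P t.+1)).
  by move=> tN; exact/input_weight_pd/riccati_next_psd.
set F := BIG_F; move=> le0.
have F0 t : (1 <= t < N)%N -> 0 <= F t.
  by move=> /W_pd/pdmx_psd[_]; exact.
have sumF0 : \sum_(1 <= t < N) F t == 0.
  by rewrite eq_le le0 big_nat sumr_ge0.
move=> t tN; rewrite dyn//; congr (_ + _ *m _).
apply/eqP; rewrite -addr_eq0; apply/negPn/negP => /((W_pd t tN).2 _).
rewrite big_nat psumr_eq0// in sumF0.
have := allP sumF0 t; rewrite mem_index_iota tN => /(_ isT) /eqP.
by rewrite /F => ->; rewrite ltxx.
Qed.

(* [stage_excess Q0 S t], as a quadratic form in the state at time [1], is the
   value at the optimal input and state at time [t] of the form defined by the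
   linear matrix inequality for [(Q0, S)]. *)
Definition stage_excess (Q0 : 'M[R]_n) (S : nat -> 'M[R]_n) t : 'M[R]_n :=
  (feedback A B (P t.+1) *m transition t.-1)^T
  *m riccati_lmi A B Q0 (S t.+1) (S t)
  *m (feedback A B (P t.+1) *m transition t.-1).

(** The sum of |u_t|^2 as a form in the initial state. It does not involve the candidate, so it
    cancels when candidates are compared. *)
Definition input_energy : 'M[R]_n :=
  \sum_(1 <= t < N) (gain A B (P t.+1) *m transition t.-1)^T
                    *m (gain A B (P t.+1) *m transition t.-1).

Lemma noiseless_objective Q0 S x :
  dynamics A B 1 N x (fun t => - (gain A B (P t.+1) *m x t)) ->
  - qform (S 1%N) (x 1%N) + qform (S N) (x N)
  + \sum_(1 <= t < N) qform Q0 (x t) =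
  qform (\sum_(1 <= t < N) stage_excess Q0 S t - input_energy) (x 1%N).
Proof.
move=> dyn; rewrite (lq_cost_telescope Q0 S dyn) qform_mxD qform_mxN !qform_sum.
rewrite -sumrB; apply: eq_big_nat => -[//|t] tN.
have -> : x t.+1 = transition t *m x 1%N.
  by apply: feedback_transition => //; exact: ltnW.
rewrite /stage_excess -qform_mul -mulmxA feedback_mul; congr (_ - _).
by rewrite /qform [(- _)^T]raddfN /= mulNmx mulmxN opprK !trmx_mul !mulmxA.
Qed.

Lemma stage_excess_riccati t : (1 <= t < N)%N -> stage_excess Q P t = 0.
Proof.
move=> tN; have [_ Pstep] := ricP.
rewrite /stage_excess (Pstep t tN : _ = riccati_step A B Q (P t.+1)) -mulmxA.
rewrite (mulmxA (riccati_lmi _ _ _ _ _)) riccati_step_feedback0.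
  by rewrite mul0mx mulmx0.
exact: riccati_next_psd.
Qed.

Lemma stage_excess_psd Q0 S t :
  psdmx (riccati_lmi A B Q0 (S t.+1) (S t)) -> psdmx (stage_excess Q0 S t).
Proof. exact: psdmx_congr. Qed.

(** The transition matrix is invertible, so every [y] occurs as a state at time [t]; a semidefinite
    form vanishing at a vector has that vector in its kernel. *)
Lemma riccati_lmi_of_excess0 Q0 S t : A \in unitmx -> (1 <= t < N)%N ->
  psdmx (riccati_lmi A B Q0 (S t.+1) (S t)) -> stage_excess Q0 S t = 0 ->
  riccati_lmi A B Q0 (S t.+1) (S t) *m feedback A B (P t.+1) = 0.
Proof.
move=> uA /andP[t0 tN] psdL E0; apply: mulmx_cV_eq0 => y.
have uPhi : transition t.-1 \in unitmx.
  by apply: transition_unit => //; rewrite prednK// ltnW.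
rewrite -mulmxA; apply: psdmx_qform_eq0 => //.
transitivity (qform (stage_excess Q0 S t) (invmx (transition t.-1) *m y)).
  by rewrite -qform_mul -mulmxA mulKVmx.
by rewrite E0 /qform mulmx0 mul0mx mxE.
Qed.

(** Both families satisfy the equations of [riccati_lmi_feedback0] with the gains of [P]; their
    difference obeys the recursion of [input_orthogonal_eq0]. *)
Lemma riccati_identifiable Q0 S : A \in unitmx -> controllable A B ->
  (n < N)%N -> (forall t, (1 <= t <= N)%N -> psdmx (S t)) -> S N = Q0 ->
  (forall t, (1 <= t < N)%N ->
     riccati_lmi A B Q0 (S t.+1) (S t) *m feedback A B (P t.+1) = 0) ->
  Q0 = Q /\ forall t, (1 <= t <= N)%N -> S t = P t.
Proof.
move=> uA ctrl nN psdS SN L0; have [PN Pstep] := ricP.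
have eqS t tN := riccati_lmi_feedback0 (L0 t tN).
have stepP t : (1 <= t < N)%N ->
    gain A B (P t.+1) = B^T *m P t.+1 *m closed_loop A B (P t.+1) /\
    P t = A^T *m P t.+1 *m closed_loop A B (P t.+1) + Q.
  move=> tN; apply: riccati_lmi_feedback0.
  rewrite (Pstep t tN : _ = riccati_step A B Q (P t.+1)).
  by apply: riccati_step_feedback0; exact: riccati_next_psd.
pose D t := S t - P t.
have BD t : (1 <= t < N)%N -> B^T *m D t.+1 = 0.
  move=> tN; have uC := closed_loop_unit B uA (riccati_next_psd tN).
  (* Both families share the gain, so B^T D_{t+1} vanishes after multiplication by the invertible
     closed loop. *)
  apply: (can_inj (mulmxK uC)).
  rewrite mul0mx /D [B^T *m _]mulmxBr mulmxBl.
  by rewrite -(eqS t tN).1 -(stepP t tN).1 subrr.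
have DB t : (1 <= t < N)%N -> D t.+1 *m B = 0.
  move=> tN; apply: trmx_inj; rewrite trmx_mul trmx0 /D raddfB /=.
  rewrite (riccati_next_psd tN).1 (psdS t.+1 _).1 ?BD//.
  by case/andP: tN.
have Dstep t : (1 <= t < N)%N -> D t = A^T *m D t.+1 *m A + (Q0 - Q).
  move=> tN; rewrite /D (eqS t tN).2 [X in _ - X](stepP t tN).2.
  rewrite opprD addrACA -mulmxBl -mulmxBr -/(D t.+1); congr (_ + _).
  (* D_{t+1} B = 0 removes the feedback part of the closed loop and leaves [A]. *)
  rewrite /closed_loop mulmxBr (mulmxA _ B) -(mulmxA A^T _ B) DB//.
  by rewrite mulmx0 mul0mx subr0.
have DN : D N = Q0 - Q by rewrite /D SN PN.
have dQ0 := input_orthogonal_eq0 uA ctrl nN DN Dstep BD.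
split=> [|t /andP[t0 tN]]; apply/eqP; rewrite -subr_eq0 ?dQ0// -/(D t).
(* Now the recursion is homogeneous and [D N] is zero, so [D] vanishes backwards in time. *)
rewrite -(subKn tN); have : (N - t < N)%N by rewrite ltn_subrL t0 N_gt0.
elim: (N - t)%N => [|s IH] sN; first by rewrite subn0 DN dQ0.
rewrite Dstep ?dQ0 ?addr0; last by apply/andP; split; lia.
by rewrite -subSn ?subSS ?(ltnW sN)// (eqP (IH (ltnW sN))) mulmx0 mul0mx.
Qed.

End Optimal.
End Trajectories.

(** * The objective as a sum over agents *)

Lemma observation_trace (U : Type) (R : realType) n M
    (x v : nat -> 'I_M -> U -> 'cV[R]_n) (permt : nat -> 'S_M) t w
    (W : 'M[R]_n) :
  \tr (W *m observation x v permt t w *m (observation x v permt t w)^T) =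
  \sum_i qform W (x t i w + v t i w).
Proof.
(* The trace sums over columns, so the unknown permutation merely reindexes the agents. *)
rewrite mxtrace_mulC (reindex_perm (permt t)).
apply: eq_bigr => i _; rewrite /qform.
set Y := observation _ _ _ _ _; set y := _ + _.
have -> : y = col i Y; first by apply/matrixP => j k; rewrite ord1 !mxE.
rewrite -mulmxA mxE [RHS]mxE; move: Y => Y.
apply: eq_bigr => j _; rewrite !mxE; congr (_ * _).
by apply: eq_bigr => k _; rewrite !mxE.
Qed.

(** Spreads the trace correction over agents and times, so that each noisy form stands next to its
    own correction, as in [mean_qform_noise]. *)
Lemma ioc_objective_observation (U : Type) (R : realType) n M N S
    (x v : nat -> 'I_M -> U -> 'cV[R]_n) (permt : nat -> 'S_M) w Q P :
  ioc_objective N S (fun t => observation x v permt t w) (Q, P) =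
  M%:R^-1 * \sum_i (
    - (qform (P 1%N) (x 1%N i w + v 1%N i w) - \tr (P 1%N *m S))
    + (qform (P N) (x N i w + v N i w) - \tr (P N *m S))
    + \sum_(1 <= t < N) (qform Q (x t i w + v t i w) - \tr (Q *m S))).
Proof.
rewrite /ioc_objective !observation_trace; congr (_ * _).
rewrite (eq_bigr (fun t => \sum_i qform Q (x t i w + v t i w))); last first.
  by move=> t _; exact: observation_trace.
rewrite exchange_big /= !big_split /= sumrN !big_split /= !sumrN.
rewrite [X in _ = _ + X](eq_bigr (fun i =>
    \sum_(1 <= t < N) qform Q (x t i w + v t i w) - N.-1%:R * \tr (Q *m S))).
  rewrite big_split /= sumrN !sumr_const card_ord.
  by rewrite -[(\tr (P 1%N *m S)) *+ M]mulr_natl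
      -[(\tr (P N *m S)) *+ M]mulr_natl
      -[(N.-1%:R * _) *+ M]mulr_natl; ring.
by move=> i _; rewrite big_split /= sumr_const_nat subn1 mulNrn mulr_natl.
Qed.

(** * Expected objective, optimality and uniqueness *)

Section EntrySum.
Context {d : measure_display} {T : measurableType d} {R : realType} {n : nat}.
Variables (Pr : probability T R) (X : T -> 'cV[R]_n) (S : 'M[R]_n).
Hypothesis mX : second_moment Pr X S.

Lemma entry_sumB V W : entry_sum (V - W) S = entry_sum V S - entry_sum W S.
Proof.
rewrite -sumrB; apply: eq_bigr => j _; rewrite -sumrB; apply: eq_bigr => k _.
by rewrite !mxE mulrBl.
Qed.

Lemma entry_sum_ge0 W : psdmx W -> 0 <= entry_sum W S.
Proof. by move=> [_ W0]; apply: has_mean_ge0 (mean_qform W mX) _ => w. Qed.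

End EntrySum.

Theorem proposition4p1
  (R : realType) (n m M N : nat)
  (A : 'M[R]_n) (B : 'M[R]_(n, m))
  (A_inv : A \in unitmx) (B_rank : \rank B = m) (AB_ctrl : controllable A B)
  (d : measure_display) (T : measurableType d) (Pr : probability T R)
  (x v : nat -> 'I_M -> T -> 'cV[R]_n)
  (Sigma Qbar : 'M[R]_n) (Pbar : nat -> 'M[R]_n) (phi : R)
  (permt : nat -> 'S_M)
  (M_gt0 : (0 < M)%N)
  (* Assumption 1 *)
  (x1_rv : forall i, random_vector (x 1%N i))
  (v_rv : forall t i, (1 <= t <= N)%N -> random_vector (v t i))
  (indep : mutually_independent Pr (primitive_family (N := N) x v))
  (x1_id : forall i j, identically_distributed Pr (x 1%N i) (x 1%N j))
  (v_id : forall s t i j, (1 <= s <= N)%N -> (1 <= t <= N)%N ->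
     identically_distributed Pr (v s i) (v t j))
  (v_mean : forall t i j, (1 <= t <= N)%N ->
     'E_Pr[fun w => (v t i w j 0)%R]%E = 0%E)
  (v_cov : forall t i, (1 <= t <= N)%N ->
     covmx Pr (v t i) = map_mx EFin Sigma)
  (* Assumption 2 *)
  (x1_cov : forall i, pdmx (map_mx fine (covmx Pr (x 1%N i))))
  (x1_sq : forall i, ('E_Pr[fun w => (frobenius (x 1%N i w) ^+ 2)%R] < +oo)%E)
  (* Assumption 3 *)
  (phi_gt0 : 0 < phi)
  (Qbar_in : psd_ball phi Qbar)
  (* noiseless states are the optimal state trajectories *)
  (x_opt : forall i w,
     optimal_trajectory A B Qbar N (x 1%N i w) (fun t => x t i w))
  (Pbar_riccati : riccati A B Qbar N Pbar)
  (N_ge : (n.+1 <= N)%N) :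
  let EH := fun z =>
    'E_Pr[fun w =>
      (ioc_objective N Sigma (fun t => observation x v permt t w) z)%R]%E in
  minimizers EH (ioc_domain A B N phi) (Qbar, Pbar) /\
  (forall Q P, minimizers EH (ioc_domain A B N phi) (Q, P) ->
     Q = Qbar /\ forall t, (1 <= t <= N)%N -> P t = Pbar t).
Proof.
have N_gt0 : (0 < N)%N := leq_ltn_trans (leq0n n) N_ge.
have psdQ : psdmx Qbar := Qbar_in.1.
pose S i : 'M[R]_n :=
  \matrix_(j, k) fine 'E_Pr[fun w => (x 1%N i w j 0 * x 1%N i w k 0)%R]%E.
have mx i : second_moment Pr (x 1%N i) (S i).
  by apply: second_moment_sqr => //; exact: integrable_coord_sqr.
have mv t i : (1 <= t <= N)%N -> second_moment Pr (v t i) Sigma.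
  move=> tN; apply: second_moment_centered; [exact: v_rv| |exact: v_cov].
  by move=> k; exact: v_mean.
(* [Sigma] is the second moment of the noise at time 1 of some agent, which exists as [M] and [N]
   are positive. *)
have symSigma : Sigma^T = Sigma.
  apply/matrixP => j k; rewrite mxE.
  have m1 := mv 1%N (Ordinal M_gt0) N_gt0.
  by apply: has_mean_unique (m1 k j) (has_mean_eq _ (erefl _) (m1 j k)) => w;
    rewrite mulrC.
have unc t i : (1 <= t <= N)%N -> uncorrelated Pr (x 1%N i) (v t i).
  move=> tN; have /andP[t0 tN'] := tN.
  have t1N : (t.-1 < N)%N by rewrite prednK.
  apply: uncorrelated_indep (mx i) (mv t i tN) _ => //; [exact: v_rv| |].
    (* Joint independence is restricted to two members, the initial state and the noise at time [t],
       whose index in ['I_N] is [t.-1]. *)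
    move=> C D bC bD; pose k0 : 'I_M + 'I_N * 'I_M := inl i.
    pose k1 : 'I_M + 'I_N * 'I_M := inr (Ordinal t1N, i).
    have := indep [set k0; k1]%SET (fun k => if k is inl _ then C else D).
    rewrite big_setU1 ?inE//= big_set1 /= prednK// => <-; last by case.
    congr (Pr _); apply/seteqP; split=> [w [Cw Dw] k|w Cw] /=.
      by rewrite !inE => /orP[] /eqP ->//=; rewrite prednK.
    split; first by apply: (Cw k0); rewrite /= !inE eqxx.
    have := Cw k1; rewrite /= prednK//; apply; by rewrite !inE eqxx orbT.
  by move=> k; exact: v_mean.
have dyn i w := optimal_trajectory_feedback N_gt0 psdQ Pbar_riccati (x_opt i w).
have xE i w t : (1 <= t <= N)%N ->
    x t i w = transition A B Pbar t.-1 *m x 1%N i w.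
  move=> /andP[]; case: t => // t _ tN.
  exact: (feedback_transition (dyn i w)).
pose a i t W :=
  entry_sum ((transition A B Pbar t.-1)^T *m W *m transition A B Pbar t.-1)
    (S i).
have noisy i t W : (1 <= t <= N)%N -> has_mean Pr
    (fun w => qform W (x t i w + v t i w) - \tr (W *m Sigma)) (a i t W).
  move=> tN.
  apply: has_mean_eq (mean_qform_noise (transition A B Pbar t.-1) W (mx i)
    (mv t i tN) (unc t i tN) symSigma) => [w|//].
  by rewrite (xE i w t tN).
have clean i t W : (1 <= t <= N)%N ->
    has_mean Pr (fun w => qform W (x t i w)) (a i t W).
  move=> tN; apply: has_mean_eq (mean_qform _ (mx i)) => [w|//].
  by rewrite (xE i w t tN) qform_mul.
have oneN : (1 <= 1 <= N)%N by rewrite N_gt0.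
have NN : (1 <= N <= N)%N by rewrite N_gt0 leqnn.
have ltN t : (1 <= t < N)%N -> (1 <= t <= N)%N.
  by move=> /andP[-> /ltnW].
pose X Q P := \sum_(1 <= t < N) stage_excess A B Pbar Q P t.
pose energy := \sum_i entry_sum (input_energy A B N Pbar) (S i).
move=> EH.
have EHE Q P : EH (Q, P) =
    (M%:R^-1 * (\sum_i entry_sum (X Q P) (S i) - energy))%:E.
  suff [_ //] : has_mean Pr (fun w => ioc_objective N Sigma
      (fun t => observation x v permt t w) (Q, P))
      (M%:R^-1 * (\sum_i entry_sum (X Q P) (S i) - energy)).
  rewrite /energy -sumrB.
  apply: (has_mean_eq
    (fun w => esym (ioc_objective_observation _ _ _ _ _ _ _ _)) (erefl _)).
  apply: has_meanZ; apply: has_mean_sum => i _.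
  have obj := has_meanD (has_meanD (has_meanN (noisy i 1%N (P 1%N) oneN))
    (noisy i N (P N) NN))
    (has_mean_sum_nat (fun t tN => noisy i t Q (ltN t tN))).
  (* Noisy and noiseless terms share the means [a], so the expected objective can be computed on
     noiseless states, where [noiseless_objective] holds pointwise. *)
  have obj0 := has_meanD (has_meanD (has_meanN (clean i 1%N (P 1%N) oneN))
    (clean i N (P N) NN))
    (has_mean_sum_nat (fun t tN => clean i t Q (ltN t tN))).
  apply: has_mean_eq obj => //; apply: has_mean_unique obj0 _.
  rewrite -entry_sumB; apply: has_mean_eq (mean_qform _ (mx i)) => [w|//].
  exact: (esym (noiseless_objective N_gt0 Q P (dyn i w))).
(* The input energy and the positive factor 1/M are common to all candidates. *)
have EH_le Q P Q' P' : (EH (Q, P) <= EH (Q', P'))%E =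
    (\sum_i entry_sum (X Q P) (S i) <= \sum_i entry_sum (X Q' P') (S i)).
  by rewrite !EHE lee_fin ler_pM2l ?invr_gt0 ?ltr0n// lerD2r.
have Xbar0 : X Qbar Pbar = 0.
  by rewrite /X big_nat big1// => t; exact: (stage_excess_riccati N_gt0).
have sum_bar : \sum_i entry_sum (X Qbar Pbar) (S i) = 0.
  rewrite big1// => i _; rewrite Xbar0 /entry_sum.
  by rewrite big1// => j _; rewrite big1// => k _; rewrite mxE mul0r.
have X_psd Q P : ioc_domain A B N phi (Q, P) -> psdmx (X Q P).
  move=> [_ _ _ lmi]; rewrite /X big_nat; apply: psdmx_sum => t tN.
  exact/stage_excess_psd/lmi.
have min_bar : minimizers EH (ioc_domain A B N phi) (Qbar, Pbar).
  split.
    have [PN Pstep] := Pbar_riccati; split=> // t tN.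
      exact: (riccati_psd N_gt0 psdQ Pbar_riccati tN).
    rewrite (Pstep t tN : _ = riccati_step A B Qbar (Pbar t.+1)).
    by apply: riccati_lmi_step_psd; exact: (riccati_next_psd N_gt0 psdQ Pbar_riccati tN).
  move=> [Q P] dom; rewrite EH_le sum_bar sumr_ge0// => i _.
  exact: (entry_sum_ge0 (mx i) (X_psd _ _ dom)).
split=> // Q P [dom /(_ _ min_bar.1)]; rewrite EH_le sum_bar => le0.
have X0 : X Q P = 0.
  (* The agents' terms are nonnegative with sum at most zero, so each is zero, and a single agent
     already forces the matrix to vanish. *)
  pose i0 := Ordinal M_gt0.
  have ge0 i : 0 <= entry_sum (X Q P) (S i).
    exact: (entry_sum_ge0 (mx i) (X_psd _ _ dom)).
  apply: (psdmx_mean0_eq0 (x1_rv i0) (mx i0)) => //; first exact: X_psd.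
  apply: has_mean_eq (mean_qform _ (mx i0)) => //.
  have : \sum_i entry_sum (X Q P) (S i) == 0 by rewrite eq_le le0 sumr_ge0.
  by rewrite psumr_eq0// => /allP/(_ i0 (mem_index_enum _))/eqP.
have [_ psdP PN lmi] := dom.
apply: (riccati_identifiable N_gt0 psdQ Pbar_riccati A_inv AB_ctrl N_ge psdP
  PN).
move=> t tN.
apply: (riccati_lmi_of_excess0 N_gt0 psdQ Pbar_riccati A_inv tN (lmi t tN)).
(* A vanishing sum of semidefinite stage excesses has only zero terms. *)
move: X0; rewrite /X big_nat => X0.
apply: (psdmx_sum_eq0 _ X0) => //; last by rewrite mem_index_iota.
by move=> s sN; exact/stage_excess_psd/lmi.
Qed.
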